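(* Among the four fixed points $P_1,P_2,P_3,P_4$, only $P_3$ can be simultaneously real and locally stable: for $i\in\{1,2,4\}$ there are no parameters $(a,c)\in\mathbb{R}^2$ for which $P_i$ is defined, $P_i\in Q_i$ and $P_i$ is locally stable. Moreover, $P_3$ is real and locally stable in the parameter region $$\{(a,c)\in\mathbb{R}^2:\ a<0,\ a>-c-1,\ |c-a|<1\},$$ and this region is non-empty.
   Context: For real parameters $a,c$, $T:\mathbb{R}^2\to\mathbb{R}^2$ is $T(x,y)=(|x|+ay-1,\;x+c|y|-1)$. The closed quadrants are $Q_1=\{x\ge 0,y\ge 0\}$, $Q_2=\{x\le 0,y\ge 0\}$, $Q_3=\{x\le 0,y\le 0\}$, $Q_4=\{x\ge 0,y\le 0\}$. On $Q_i$ the map $T$ coincides with the affine map $T_i$, where $T_1(x,y)=(x+ay-1,x+cy-1)$, $T_2(x,y)=(-x+ay-1,x+cy-1)$, $T_3(x,y)=(-x+ay-1,x-cy-1)$, $T_4(x,y)=(x+ay-1,x-cy-1)$. The linear parts are $J_1=\begin{pmatrix}1&a\\1&c\end{pmatrix}$, $J_2=\begin{pmatrix}-1&a\\1&c\end{pmatrix}$, $J_3=\begin{pmatrix}-1&a\\1&-c\end{pmatrix}$, $J_4=\begin{pmatrix}1&a\\1&-c\end{pmatrix}$. The points $P_1=\left(\frac{a-c+1}{a},\frac1a\right)$, $P_2=\left(\frac{a-c+1}{a+2c-2},\frac{3}{a+2c-2}\right)$, $P_3=\left(\frac{a+c+1}{a-2c-2},\frac{3}{a-2c-2}\right)$, $P_4=\left(\frac{a+c+1}{a},\frac1a\right)$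 are the fixed points of $T_1,T_2,T_3,T_4$ respectively (defined when the denominators are nonzero). $P_i$ is called real if $P_i\in Q_i$. $P_i$ is called locally stable if all eigenvalues $\lambda\in\mathbb{C}$ of $J_i$ satisfy $|\lambda|<1$. *)

(* Defs.v *)
From HB Require Import structures.
From mathcomp Require Import all_boot all_order all_algebra.
From mathcomp Require Import complex.
From mathcomp Require Import classical_sets reals.
From mathcomp Require Import ring lra.

Set Implicit Arguments.
Unset Strict Implicit.
Unset Printing Implicit Defensive.

Import Order.TTheory GRing.Theory Num.Theory.
Local Open Scope classical_set_scope.
Local Open Scope ring_scope.

Definition T (R : realType) (a c : R) (p : R * R) : R * R :=
  (`|p.1| + a * p.2 - 1, p.1 + c * `|p.2| - 1).

(* Serves as the index i of Q_i, T_i (here branch i), J_i and P_i. *)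
Variant quadrant := q1 | q2 | q3 | q4.

Definition Q (R : realType) (i : quadrant) : set (R * R) :=
  match i with
  | q1 => [set p | 0 <= p.1 /\ 0 <= p.2]
  | q2 => [set p | p.1 <= 0 /\ 0 <= p.2]
  | q3 => [set p | p.1 <= 0 /\ p.2 <= 0]
  | q4 => [set p | 0 <= p.1 /\ p.2 <= 0]
  end.

Definition branch (R : realType) (i : quadrant) (a c : R) (p : R * R) : R * R :=
  let: (x, y) := p in
  match i with
  | q1 => (x + a * y - 1, x + c * y - 1)
  | q2 => (- x + a * y - 1, x + c * y - 1)
  | q3 => (- x + a * y - 1, x - c * y - 1)
  | q4 => (x + a * y - 1, x - c * y - 1)
  end.

Definition mx_of_rows (R : realType) (rows : seq (seq R)) : 'M[R]_2 :=
  \matrix_(j < 2, k < 2) nth 0 (nth [::] rows j) k.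

Definition J (R : realType) (i : quadrant) (a c : R) : 'M[R]_2 :=
  match i with
  | q1 => mx_of_rows [:: [:: 1; a]; [:: 1; c]]
  | q2 => mx_of_rows [:: [:: - 1; a]; [:: 1; c]]
  | q3 => mx_of_rows [:: [:: - 1; a]; [:: 1; - c]]
  | q4 => mx_of_rows [:: [:: 1; a]; [:: 1; - c]]
  end.

(* The common denominator of the coordinates of P_i. *)
Definition denP (R : realType) (i : quadrant) (a c : R) : R :=
  match i with
  | q1 | q4 => a
  | q2 => a + 2 * c - 2
  | q3 => a - 2 * c - 2
  end.

(* Division by 0 is total, so P i a c is meaningful only under
   P_defined i a c. *)
Definition P (R : realType) (i : quadrant) (a c : R) : R * R :=
  match i with
  | q1 => ((a - c + 1) / a, 1 / a)
  | q2 => ((a - c + 1) / (a + 2 * c - 2), 3 / (a + 2 * c - 2))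
  | q3 => ((a + c + 1) / (a - 2 * c - 2), 3 / (a - 2 * c - 2))
  | q4 => ((a + c + 1) / a, 1 / a)
  end.

Definition P_defined (R : realType) (i : quadrant) (a c : R) : Prop :=
  denP i a c != 0.

Definition P_real (R : realType) (i : quadrant) (a c : R) : Prop :=
  Q i (P i a c).

(* The eigenvalues range over the complex numbers R[i].  The norm on R[i] is
   the modulus, as a complex number with zero imaginary part.
   MathComp eigenvectors are row vectors, which yields the same spectrum. *)
Definition P_locally_stable (R : realType) (i : quadrant) (a c : R) : Prop :=
  forall z : R[i], eigenvalue (map_mx (real_complex R) (J i a c)) z -> `|z| < 1.

Definition stable_region (R : realType) : set (R * R) :=
  [set ac | let: (a, c) := ac in [/\ a < 0, a > - c - 1 & `|c - a| < 1]].
Arguments stable_region : clear implicits.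

Lemma branchE (R : realType) (i : quadrant) (a c : R) (p : R * R) :
  Q i p -> T a c p = branch i a c p.
Proof.
case: p => x y; rewrite /T; case: i => /= -[hx hy];
  by rewrite ?(ger0_norm hx) ?(ler0_norm hx) ?(ger0_norm hy) ?(ler0_norm hy)
    ?mulrN.
Qed.

Lemma branch_linear_part (R : realType) (i : quadrant) (a c : R) (x y : R) :
  J i a c *m \col_j nth 0 [:: x; y] j - const_mx 1 =
  \col_j nth 0 [:: (branch i a c (x, y)).1; (branch i a c (x, y)).2] j.
Proof.
by apply/colP => -[[|[|//]] ?]; case: i;
  rewrite !mxE !big_ord_recl big_ord0 !mxE /=; ring.
Qed.

Lemma branch_fixed (R : realType) (i : quadrant) (a c : R) (p : R * R) :
  P_defined i a c -> (branch i a c p = p <-> p = P i a c).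
Proof.
case: p => x y; rewrite /P_defined; case: i => /= d; split; case => h1 h2.
- have y_eq : y = 1 / a by apply: (mulfI d); rewrite mulrCA mulfV //; lra.
  have -> : x = 1 + y - c * y by lra.
  by rewrite y_eq; congr pair; field.
- by rewrite h1 h2; congr pair; field.
- have y_eq : y = 3 / (a + 2 * c - 2).
    by apply: (mulfI d); rewrite mulrCA mulfV //; lra.
  have -> : x = 1 + y - c * y by lra.
  by rewrite y_eq; congr pair; field.
- by rewrite h1 h2; congr pair; field.
- have y_eq : y = 3 / (a - 2 * c - 2).
    by apply: (mulfI d); rewrite mulrCA mulfV //; lra.
  have -> : x = 1 + y + c * y by lra.
  by rewrite y_eq; congr pair; field.
- by rewrite h1 h2; congr pair; field.
- have y_eq : y = 1 / a by apply: (mulfI d); rewrite mulrCA mulfV //; lra.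
  have -> : x = 1 + y + c * y by lra.
  by rewrite y_eq; congr pair; field.
- by rewrite h1 h2; congr pair; field.
Qed.

(* Main.v *)
Require Import Defs.
From HB Require Import structures.
From mathcomp Require Import all_boot all_order all_algebra.
From mathcomp Require Import complex.
From mathcomp Require Import classical_sets reals.
From mathcomp Require Import ring lra.

(** For a real 2 x 2 matrix with trace t and determinant d, the eigenvalues are
    the roots of p(z) = z ^ 2 - t z + d, and all of them lie in the open unit
    disc iff p(1) > 0, p(-1) > 0 and d < 1 (Jury's criterion,
    [jury_quadratic]).  Stability of P_i thereby becomes three linear
    inequalities in (a, c) ([P_locally_stableP]), and so does membership of P_i
    in Q_i once the sign of its denominator is known.  Comparing them:
    - P_1 in Q_1 forces a > 0, but p(1) = - a for J_1;
    - P_2 in Q_2 forces a + 2 c - 2 > 0, but p(1) = - (a + 2 c - 2) for J_2;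
    - P_4 in Q_4 forces a < 0 and then a + c + 1 <= 0, so that
      det J_4 = - (a + c) >= 1;
    - for J_3 one has p(1) = 2 + 2 c - a, p(-1) = - a and det J_3 = c - a.  In
      the region, a > - c - 1 and c - a > - 1 add up to c > - 1, hence
      p(1) > - a > 0; as p(1) is the opposite of the denominator of P_3, the
      point P_3 is defined and has two negative coordinates. *)

Import Order.TTheory GRing.Theory Num.Theory.
Local Open Scope classical_set_scope.
Local Open Scope ring_scope.
Local Open Scope complex_scope.

Lemma eigenvalue_mx2 (F : fieldType) (A : 'M[F]_2) (z : F) :
  eigenvalue A z = (z ^+ 2 - \tr A * z + \det A == 0).
Proof.
rewrite eigenvalue_root_char /root horner_coef size_char_poly.
have lead1 : (char_poly A)`_2 = 1.
  by have /monicP := char_poly_monic A; rewrite lead_coefE size_char_poly.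
rewrite !big_ord_recl big_ord0 /= /bump /= lead1.
rewrite (char_poly_trace A isT) char_poly_det.
by congr (_ == 0); ring.
Qed.

Lemma det_mx_of_rows (R : realType) (x y z w : R) :
  \det (mx_of_rows [:: [:: x; y]; [:: z; w]]) = x * w - y * z.
Proof.
rewrite (expand_det_row _ ord0) !big_ord_recl big_ord0 /cofactor !det_mx11.
by rewrite !mxE /=; ring.
Qed.

Lemma tr_mx_of_rows (R : realType) (x y z w : R) :
  \tr (mx_of_rows [:: [:: x; y]; [:: z; w]]) = x + w.
Proof. by rewrite /mxtrace !big_ord_recl big_ord0 !mxE /= addr0. Qed.

Lemma real_quadratic_complex (R : rcfType) (t d x : R) :
  x ^+ 2 - t * x + d = 0 -> x%:C ^+ 2 - t%:C * x%:C + d%:C = 0.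
Proof. by move=> e; rewrite -rmorphXn -rmorphM -rmorphB -rmorphD /= e. Qed.

Lemma normr_real_complex_lt1 (R : rcfType) (x : R) : `|x%:C| < 1 -> `|x| < 1.
Proof.
move=> x1; rewrite -(ltcR `|x| 1).
by apply: le_lt_trans x1; apply: (normc_ge_Re x%:C).
Qed.

(** If p(1) <= 0 then t ^ 2 - 4 d >= (t - 2) ^ 2, so the larger root of p is
    real and at least (t + (2 - t)) / 2 = 1. *)
Lemma quadratic_root_ge1 (R : rcfType) (t d : R) :
  1 - t + d <= 0 -> exists2 x : R, x ^+ 2 - t * x + d = 0 & 1 <= x.
Proof.
move=> p1; set D := t ^+ 2 - 4 * d.
have leD : (2 - t) ^+ 2 <= D by rewrite /D; nra.
have D0 : 0 <= D by apply: le_trans leD; exact: sqr_ge0.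
have s2 := sqr_sqrtr D0.
have les : 2 - t <= Num.sqrt D.
  by apply: le_trans (ler_norm _) _; rewrite -sqrtr_sqr ler_sqrt.
exists ((t + Num.sqrt D) / 2); last by lra.
rewrite (_ : _ + d = (Num.sqrt D ^+ 2 - t ^+ 2 + 4 * d) / 4); last by field.
by rewrite s2 /D; field.
Qed.

(** A non-real root z has its conjugate as other root, so |z| ^ 2 = d < 1.  If
    p has a real root outside ]-1, 1[, then p(1) > 0 and p(-1) > 0 push the
    other root beyond the same endpoint, and d, the product of the two, would
    exceed 1.  Conversely d is the product of two roots of modulus < 1, and
    p(1) <= 0 or p(-1) <= 0 would produce a real root of absolute value at
    least 1. *)
Lemma jury_quadratic (R : rcfType) (t d : R) :
  (forall z : R[i], z ^+ 2 - t%:C * z + d%:C = 0 -> `|z| < 1) <->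
  [/\ 0 < 1 - t + d, 0 < 1 + t + d & d < 1].
Proof.
split=> [stab | [p1 pN1 d1] [x y] /eqP].
  split.
  - rewrite ltNge; apply/negP => /quadratic_root_ge1 [x xroot x1].
    have /normr_real_complex_lt1 := stab _ (real_quadratic_complex _ _ _ _ xroot).
    by rewrite ltr_norml => /andP[_]; rewrite ltNge x1.
  (* p(-z) is the quadratic with trace - t, whose value at 1 is p(-1). *)
  - rewrite ltNge -[t in 1 + t]opprK; apply/negP.
    move=> /quadratic_root_ge1 [x xroot x1].
    have Nxroot : (- x) ^+ 2 - t * (- x) + d = 0 by rewrite -xroot; ring.
    have /normr_real_complex_lt1 := stab _ (real_quadratic_complex _ _ _ _ Nxroot).
    by rewrite normrN ltr_norml => /andP[_]; rewrite ltNge x1.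
  - pose s := sqrtc (t ^+ 2 - 4 * d)%:C.
    have s2 : s ^+ 2 = t%:C ^+ 2 - 4 * d%:C.
      by rewrite sqr_sqrtc rmorphB rmorphXn rmorphM /= rmorph_nat.
    have root_half (e : R[i]) : e ^+ 2 = s ^+ 2 -> `|(t%:C + e) / 2| < 1.
      move=> e2; apply: stab.
      rewrite (_ : _ + _ = (e ^+ 2 - t%:C ^+ 2 + 4 * d%:C) / 4); last by field.
      by rewrite e2 s2; field.
    have dE : d%:C = (t%:C + s) / 2 * ((t%:C - s) / 2).
      rewrite (_ : _ / 2 * _ = (t%:C ^+ 2 - s ^+ 2) / 4); last by field.
      by rewrite s2; field.
    have /normr_real_complex_lt1 : `|d%:C| < 1.
      by rewrite dE normrM mulr_ilt1 // root_half ?sqrrN.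
    by rewrite ltr_norml => /andP[].
rewrite eq_complex /= => /andP[/eqP re /eqP im].
rewrite normc_def (ltcR _ 1) -sqrtr1 ltr_sqrt //=.
have [y0|y0] := eqVneq y 0.
  rewrite {}y0 in re *.
  have rootr : d = x * (t - x) by lra.
  have xlt1 : x < 1 by rewrite ltNge; apply/negP => x1; nra.
  have xgtN1 : -1 < x by rewrite ltNge; apply/negP => x1; nra.
  by nra.
have tx : t = 2 * x by apply: (mulIf y0); lra.
by subst t; nra.
Qed.

Lemma P_locally_stableP (R : realType) (i : quadrant) (a c : R) :
  P_locally_stable i a c <->
  [/\ 0 < 1 - \tr (J i a c) + \det (J i a c),
      0 < 1 + \tr (J i a c) + \det (J i a c) & \det (J i a c) < 1].
Proof.
rewrite -jury_quadratic /P_locally_stable.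
have tr_map (A : 'M[R]_2) : \tr (map_mx (real_complex R) A) = (\tr A)%:C.
  exact: trace_map_mx.
by split=> stab z zroot; apply: stab; move: zroot;
  rewrite eigenvalue_mx2 tr_map det_map_mx => /eqP.
Qed.

Theorem proposition3p4 (R : realType) :
  [/\ forall i : quadrant, i <> q3 ->
        ~ exists a c : R,
            [/\ P_defined i a c, P_real i a c & P_locally_stable i a c],
      forall a c : R, stable_region R (a, c) ->
        [/\ P_defined q3 a c, P_real q3 a c & P_locally_stable q3 a c]
    & stable_region R !=set0].
Proof.
split.
- case=> // _ [a [c [/= d0 [/= hx hy] /P_locally_stableP]]];
    rewrite det_mx_of_rows tr_mx_of_rows => -[p1 _ d1].
  + have a0 : 0 <= a by move: hy; rewrite div1r invr_ge0.
    by lra.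
  + have den0 : 0 <= a + 2 * c - 2 by move: hy; rewrite pmulr_rge0 ?invr_ge0.
    by lra.
  + have a0 : a < 0 by rewrite lt_neqAle d0; move: hy; rewrite div1r invr_le0.
    have num0 : a + c + 1 <= 0 by move: hx; rewrite ler_ndivlMr // mul0r.
    by lra.
- move=> a c [a0 ac1]; rewrite ltr_norml => /andP[cagtN1 calt1].
  have den0 : a - 2 * c - 2 < 0 by lra.
  split.
  + by rewrite /P_defined /= lt_eqF.
  + by split; rewrite /= ler_ndivrMr // mul0r; lra.
  + by apply/P_locally_stableP; rewrite det_mx_of_rows tr_mx_of_rows; split; lra.
- exists (- 2^-1, 0); split; [lra | lra |].
  by rewrite ltr_norml; lra.
Qed.
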